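(* Let $x\colon\mathbb{Z}^2\to\mathbb{R}^3$, $x(m,n)=\bigl(f(n)\cos\frac{2\pi m}{l},\,f(n)\sin\frac{2\pi m}{l},\,h(n)\bigr)$, be a discrete surface of revolution with unit normal $\nu(m,n)=\bigl(a(n)\cos\frac{2\pi m}{l},\,a(n)\sin\frac{2\pi m}{l},\,b(n)\bigr)$, and suppose it has constant Gaussian curvature $K=-1$. Let $k_2\ge 0$ be an integer and assume $f(n)\ge 0$ for all $0\le n\le k_2$. Then the following three statements hold. (1) If $$f(0)=1,\quad h(0)=0,\quad a(0)=0,\quad b(0)=1,$$ $$a(n)=\tanh u_n,\qquad b(n)=\frac{1}{\cosh u_n}\qquad(0\le n\le k_2)$$ for some sequence of real numbers $u_0<u_1<\cdots<u_{k_2}$, then the profile curve is given by $$(f(n),h(n))=\Bigl(\frac{1}{\cosh u_n},\ \sum_{i=1}^{n}\frac{(\cosh u_i-\cosh u_{i-1})^2}{\sinh(u_i-u_{i-1})\cosh u_i\cosh u_{i-1}}\Bigr)\qquad(0<n\le k_2).$$ (2) If $$f(0)=p,\quad h(0)=0,\quad a(0)=1,\quad b(0)=0,$$ $$a(n)=\sqrt{1-p^2\sinh^2u_n},\qquad b(n)=-p\sinh u_n\qquad(0\le n\le k_2)$$ for some $p>0$ and some sequence of real numbers $u_0<u_1<\cdots<u_{k_2}$, then the profile curve is given by $$(f(n),h(n))=\Bigl(p\cosh u_n,\ \sum_{i=1}^{n}\frac{(-p\sinh u_i+p\sinh u_{i-1})(p\cosh u_i-p\cosh u_{i-1})}{\sqrt{1-p^2\sinh^2u_i}-\sqrt{1-p^2\sinh^2u_{i-1}}}\Bigr)\qquad(0<n\le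 k_2).$$ (3) If $$f(0)=q\sinh u_0,\quad h(0)=0,\quad a(0)=0,\quad b(0)=1,$$ $$a(n)=\sqrt{1-q^2\cosh^2u_n},\qquad b(n)=q\cosh u_n\qquad(0\le n\le k_2)$$ for some $0<q<1$ and some sequence of real numbers $u_0>u_1>\cdots>u_{k_2}$, then the profile curve is given by $$(f(n),h(n))=\Bigl(q\sinh u_n,\ \sum_{i=1}^{n}\frac{(q\cosh u_i-q\cosh u_{i-1})(q\sinh u_i-q\sinh u_{i-1})}{\sqrt{1-q^2\cosh^2u_i}-\sqrt{1-q^2\cosh^2u_{i-1}}}\Bigr)\qquad(0<n\le k_2).$$
   Context: Here $f,h\colon\mathbb{Z}\to\mathbb{R}$ are functions with $(f(n),h(n))\ne(f(n+1),h(n+1))$ for all $n$, and $l$ is a positive integer (the number of divisions in the rotational direction). The profile curve is $n\mapsto(f(n),h(n))$. Unit normal: $a,b\colon\mathbb{Z}\to\mathbb{R}$ satisfy $a(n)^2+b(n)^2=1$ and, for every $n$, writing $\Delta f=f(n+1)-f(n)$ and $\Delta h=h(n+1)-h(n)$, $$a(n+1)=a(n)-\frac{2\,\Delta f\,(a(n)\Delta f+b(n)\Delta h)}{(\Delta f)^2+(\Delta h)^2},\qquad b(n+1)=b(n)-\frac{2\,\Delta h\,(a(n)\Delta f+b(n)\Delta h)}{(\Delta f)^2+(\Delta h)^2}.$$ That is, $(a(n+1),b(n+1))$ is the reflection of $(a(n),b(n))$ in the line through the origin orthogonal to the edge vector $(\Delta f,\Delta h)$. The normal at one index may be chosen freely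 and determines the others. Gaussian curvature: on the layer of faces between $n$ and $n+1$ it is $$K(n)=\frac{a(n+1)^2-a(n)^2}{f(n+1)^2-f(n)^2}.$$ The surface has constant Gaussian curvature $K=c$ if, for every $n$, this quotient is defined and equals $c$. The square roots in the statement are square roots of nonnegative reals; this is implicit in the assumption that $a(n)$ has the given form.
   Formalization: In part (3) it is additionally assumed that u_n ≥ 0 for 0 ≤ n ≤ k_2; otherwise a(n), b(n) do not fix the sign of u_n and the formula f(n) = q sinh u_n fails, e.g. q = 3/5, u_0 = ln 3, u_1 = -ln 2, where f(1) = 9/20. *)

(* Defs.v *)
From Stdlib Require Import Reals ZArith.
Open Scope R_scope.

Definition revolve (l : Z) (r z : Z -> R) (m n : Z) : R * R * R :=
  (r n * cos (2 * PI * IZR m / IZR l), r n * sin (2 * PI * IZR m / IZR l), z n).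

Definition fdiff (g : Z -> R) (n : Z) : R := g (n + 1)%Z - g n.

Record surface_of_revolution (l : Z) (f h : Z -> R) (x : Z -> Z -> R * R * R) : Prop := {
  divisions_pos : (0 < l)%Z;
  profile_edges : forall n, (f n, h n) <> (f (n + 1)%Z, h (n + 1)%Z);
  surface_eq : forall m n, x m n = revolve l f h m n }.

(* The last two equations say that (a (n + 1), b (n + 1)) is the reflection of (a n, b n) in the
   line through the origin orthogonal to the profile edge (fdiff f n, fdiff h n). *)
Record unit_normal (l : Z) (f h a b : Z -> R) (nu : Z -> Z -> R * R * R) : Prop := {
  normal_eq : forall m n, nu m n = revolve l a b m n;
  normal_unit : forall n, a n ^ 2 + b n ^ 2 = 1;
  normal_reflect_a : forall n,
    a (n + 1)%Z = a n - 2 * fdiff f n * (a n * fdiff f n + b n * fdiff h n)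
                        / (fdiff f n ^ 2 + fdiff h n ^ 2);
  normal_reflect_b : forall n,
    b (n + 1)%Z = b n - 2 * fdiff h n * (a n * fdiff f n + b n * fdiff h n)
                        / (fdiff f n ^ 2 + fdiff h n ^ 2) }.

(* Curvature of the layer of faces between the profile vertices n and n + 1; the quotient does not
   depend on m. *)
Definition gauss_curvature (f a : Z -> R) (n : Z) : R :=
  (a (n + 1)%Z ^ 2 - a n ^ 2) / (f (n + 1)%Z ^ 2 - f n ^ 2).

Definition constant_gauss_curvature (f a : Z -> R) (c : R) : Prop :=
  forall n, f (n + 1)%Z ^ 2 - f n ^ 2 <> 0 /\ gauss_curvature f a n = c.

(* Main.v *)
(* With [K = -1] the quantity [f ^ 2 + a ^ 2] does not depend on [n], which together with [0 <= f]
   determines [f] from [a]. Since a reflection moves the normal along the profile edge, the change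
   of [(a, b)] is parallel to that of [(f, h)]; as [K <> 0] forces [a] to change at every step,
   [fdiff h = fdiff b * fdiff f / fdiff a], and [h] is obtained by summation. *)

Require Import Defs.
From Stdlib Require Import Reals ZArith Lra Lia.
Open Scope R_scope.

Lemma cosh_pos (x : R) : 0 < cosh x.
Proof. unfold cosh; pose proof (exp_pos x); pose proof (exp_pos (- x)); lra. Qed.

Lemma cosh_neq_0 (x : R) : cosh x <> 0.
Proof. apply Rgt_not_eq, cosh_pos. Qed.

Lemma cosh_sqr (x : R) : cosh x ^ 2 = 1 + sinh x ^ 2.
Proof.
  unfold cosh, sinh; rewrite exp_Ropp; field.
  pose proof (exp_pos x); lra.
Qed.

Lemma sinh_minus (x y : R) : sinh (x - y) = sinh x * cosh y - cosh x * sinh y.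
Proof.
  unfold sinh, cosh.
  replace (- (x - y)) with (- x + y) by ring.
  unfold Rminus; rewrite !exp_plus; field.
Qed.

Lemma sinh_nonneg (x : R) : 0 <= x -> 0 <= sinh x.
Proof.
  intros [Hx | <-].
  - rewrite <- sinh_0; left; apply sinh_lt, Hx.
  - rewrite sinh_0; apply Rle_refl.
Qed.

(** Telescoping. The edge from [n] to [n + 1] carries the summand of index [S n], so the summation
    starts at 1 and ends at [n]. *)
Lemma sum_f_fdiff (h : Z -> R) (g : nat -> R) (k : nat) :
  h 0%Z = 0 ->
  (forall n : nat, (n < k)%nat -> fdiff h (Z.of_nat n) = g (S n)) ->
  forall n : nat, (0 < n <= k)%nat -> h (Z.of_nat n) = sum_f 1 n g.
Proof.
  intros H0 Hg n [Hpos Hle].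
  destruct n as [|n]; [lia|]; clear Hpos.
  unfold sum_f; rewrite Nat.sub_succ, Nat.sub_0_r.
  induction n as [|n IH].
  - specialize (Hg 0%nat ltac:(lia)); unfold fdiff in Hg; simpl in *; lra.
  - specialize (IH ltac:(lia)); specialize (Hg (S n) ltac:(lia)).
    unfold fdiff in Hg.
    rewrite tech5, <- IH, Nat.add_1_r, <- Hg.
    replace (Z.of_nat (S n) + 1)%Z with (Z.of_nat (S (S n))) by lia; ring.
Qed.

Lemma const_curvature_step (f a : Z -> R) (c : R) (n : Z) :
  constant_gauss_curvature f a c ->
  a (n + 1)%Z ^ 2 - a n ^ 2 = c * (f (n + 1)%Z ^ 2 - f n ^ 2).
Proof.
  intros HK; destruct (HK n) as [Hne <-].
  unfold gauss_curvature; field; exact Hne.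
Qed.

(** Discrete first integral: the curvature equation, cleared of its denominator, says that one step
    leaves this combination unchanged. For [c = -1] it is [a ^ 2 + f ^ 2]. *)
Lemma const_curvature_invariant (f a : Z -> R) (c : R) (n : nat) :
  constant_gauss_curvature f a c ->
  a (Z.of_nat n) ^ 2 - c * f (Z.of_nat n) ^ 2 = a 0%Z ^ 2 - c * f 0%Z ^ 2.
Proof.
  intros HK; induction n as [|n IH]; [reflexivity|].
  pose proof (const_curvature_step f a c (Z.of_nat n) HK).
  replace (Z.of_nat (S n)) with (Z.of_nat n + 1)%Z by lia; lra.
Qed.

(** If [a] stayed constant on an edge, the cleared equation would make [c] times a nonzero
    difference of squares vanish. *)
Lemma const_curvature_fdiff_neq_0 (f a : Z -> R) (c : R) (n : Z) :
  c <> 0 -> constant_gauss_curvature f a c -> fdiff a n <> 0.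
Proof.
  intros Hc HK Ha; unfold fdiff in Ha.
  pose proof (const_curvature_step f a c n HK) as H.
  destruct (HK n) as [Hne _].
  replace (a (n + 1)%Z) with (a n) in H by lra.
  rewrite Rminus_diag in H; symmetry in H.
  apply Rmult_integral in H; tauto.
Qed.

Lemma normal_parallel_edge (l : Z) (f h a b : Z -> R) (nu : Z -> Z -> R * R * R) (n : Z) :
  unit_normal l f h a b nu -> fdiff a n * fdiff h n = fdiff b n * fdiff f n.
Proof.
  intros Hnu.
  unfold fdiff at 1 3.
  rewrite (normal_reflect_a _ _ _ _ _ _ Hnu n), (normal_reflect_b _ _ _ _ _ _ Hnu n).
  (* Both coordinates change by the same multiple of the edge vector; the reciprocal of the squared
     edge length is an atom for [ring]. *)
  unfold Rdiv; ring.
Qed.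

Lemma const_curvature_fdiff_height (l : Z) (f h a b : Z -> R) (nu : Z -> Z -> R * R * R)
    (c : R) (n : Z) :
  c <> 0 -> unit_normal l f h a b nu -> constant_gauss_curvature f a c ->
  fdiff h n = fdiff b n * fdiff f n / fdiff a n.
Proof.
  intros Hc Hnu HK.
  rewrite <- (normal_parallel_edge _ _ _ _ _ _ n Hnu).
  field; exact (const_curvature_fdiff_neq_0 f a c n Hc HK).
Qed.

Lemma pow2_inj_nonneg (x y : R) : 0 <= x -> 0 <= y -> x ^ 2 = y ^ 2 -> x = y.
Proof. intros Hx Hy H; apply Rsqr_inj; unfold Rsqr; lra. Qed.

(** Common reduction of the three cases: [F] is the proposed radius and [g] the proposed height
    increment. Each case then only has to check the sign of [F], the first integral for [F], and an
    identity for [g] in which [fdiff a] may be taken nonzero. *)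
Lemma neg_const_curvature_profile (l : Z) (f h a b : Z -> R) (nu : Z -> Z -> R * R * R) (k : nat)
    (F g : nat -> R) :
  unit_normal l f h a b nu -> constant_gauss_curvature f a (-1) ->
  (forall n : nat, (n <= k)%nat -> 0 <= f (Z.of_nat n)) ->
  (forall n : nat, (n <= k)%nat -> 0 <= F n) ->
  (forall n : nat, (n <= k)%nat ->
     F n ^ 2 = f 0%Z ^ 2 + a 0%Z ^ 2 - a (Z.of_nat n) ^ 2) ->
  h 0%Z = 0 ->
  (forall n : nat, (n < k)%nat -> fdiff a (Z.of_nat n) <> 0 ->
     fdiff b (Z.of_nat n) * (F (S n) - F n) / fdiff a (Z.of_nat n) = g (S n)) ->
  forall n : nat, (0 < n <= k)%nat ->
    (f (Z.of_nat n), h (Z.of_nat n)) = (F n, sum_f 1 n g).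
Proof.
  intros Hnu HK Hf HF HF2 Hh0 Hg.
  assert (HfF : forall n, (n <= k)%nat -> f (Z.of_nat n) = F n).
  { intros n Hn; apply pow2_inj_nonneg; [auto | auto |].
    rewrite (HF2 n Hn); pose proof (const_curvature_invariant f a _ n HK); lra. }
  intros n Hn; f_equal; [apply HfF; lia|].
  apply sum_f_fdiff with (k := k); [exact Hh0 | | exact Hn].
  intros i Hi.
  rewrite (const_curvature_fdiff_height l f h a b nu (-1) _ ltac:(lra) Hnu HK), <- Hg;
    [| exact Hi | apply (const_curvature_fdiff_neq_0 f a (-1)); [lra | exact HK]].
  (* Only the difference of [f] is expanded, to be replaced by that of [F]; those of [a] and [b]
     already agree on both sides. *)
  unfold fdiff at 2.
  replace (Z.of_nat i + 1)%Z with (Z.of_nat (S i)) by lia.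
  now rewrite !HfF by lia.
Qed.

Theorem theorem12 (l : Z) (f h a b : Z -> R) (x nu : Z -> Z -> R * R * R) (k2 : nat)
  (Hx : surface_of_revolution l f h x)
  (Hnu : unit_normal l f h a b nu)
  (HK : constant_gauss_curvature f a (-1))
  (Hf : forall n : nat, (n <= k2)%nat -> 0 <= f (Z.of_nat n)) :
  (forall u : nat -> R,
     f 0%Z = 1 -> h 0%Z = 0 -> a 0%Z = 0 -> b 0%Z = 1 ->
     (forall n : nat, (n < k2)%nat -> u n < u (S n)) ->
     (forall n : nat, (n <= k2)%nat ->
        a (Z.of_nat n) = tanh (u n) /\ b (Z.of_nat n) = 1 / cosh (u n)) ->
     forall n : nat, (0 < n <= k2)%nat ->
       (f (Z.of_nat n), h (Z.of_nat n)) =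
       (1 / cosh (u n),
        sum_f 1 n (fun i =>
          (cosh (u i) - cosh (u (i - 1)%nat)) ^ 2
          / (sinh (u i - u (i - 1)%nat) * cosh (u i) * cosh (u (i - 1)%nat)))))
  /\
  (forall (p : R) (u : nat -> R),
     0 < p ->
     f 0%Z = p -> h 0%Z = 0 -> a 0%Z = 1 -> b 0%Z = 0 ->
     (forall n : nat, (n < k2)%nat -> u n < u (S n)) ->
     (forall n : nat, (n <= k2)%nat ->
        0 <= 1 - p ^ 2 * sinh (u n) ^ 2 /\
        a (Z.of_nat n) = sqrt (1 - p ^ 2 * sinh (u n) ^ 2) /\
        b (Z.of_nat n) = - p * sinh (u n)) ->
     forall n : nat, (0 < n <= k2)%nat ->
       (f (Z.of_nat n), h (Z.of_nat n)) =
       (p * cosh (u n),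
        sum_f 1 n (fun i =>
          (- p * sinh (u i) + p * sinh (u (i - 1)%nat))
          * (p * cosh (u i) - p * cosh (u (i - 1)%nat))
          / (sqrt (1 - p ^ 2 * sinh (u i) ^ 2)
             - sqrt (1 - p ^ 2 * sinh (u (i - 1)%nat) ^ 2)))))
  /\
  (forall (q : R) (u : nat -> R),
     0 < q < 1 ->
     f 0%Z = q * sinh (u 0%nat) -> h 0%Z = 0 -> a 0%Z = 0 -> b 0%Z = 1 ->
     (forall n : nat, (n < k2)%nat -> u n > u (S n)) ->
     (forall n : nat, (n <= k2)%nat -> 0 <= u n) ->
     (forall n : nat, (n <= k2)%nat ->
        0 <= 1 - q ^ 2 * cosh (u n) ^ 2 /\
        a (Z.of_nat n) = sqrt (1 - q ^ 2 * cosh (u n) ^ 2) /\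
        b (Z.of_nat n) = q * cosh (u n)) ->
     forall n : nat, (0 < n <= k2)%nat ->
       (f (Z.of_nat n), h (Z.of_nat n)) =
       (q * sinh (u n),
        sum_f 1 n (fun i =>
          (q * cosh (u i) - q * cosh (u (i - 1)%nat))
          * (q * sinh (u i) - q * sinh (u (i - 1)%nat))
          / (sqrt (1 - q ^ 2 * cosh (u i) ^ 2)
             - sqrt (1 - q ^ 2 * cosh (u (i - 1)%nat) ^ 2))))).
Proof.
  assert (HS : forall (w : Z -> R) n, fdiff w (Z.of_nat n) = w (Z.of_nat (S n)) - w (Z.of_nat n)).
  { intros w n; unfold fdiff; do 2 f_equal; lia. }
  split; [|split].
  - intros u Hf0 Hh0 Ha0 _ _ Hab.
    apply (neg_const_curvature_profile l f h a b nu k2 (fun n => 1 / cosh (u n)) _ Hnu HK Hf).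
    + intros n _; apply Rlt_le, Rdiv_lt_0_compat; [lra | apply cosh_pos].
    + intros n Hn; destruct (Hab n Hn) as [-> _]; rewrite Hf0, Ha0.
      (* The first integral equals 1 here, so the claim is that [1 / cosh ^ 2] is [1 - tanh ^ 2]. *)
      pose proof (cosh_neq_0 (u n)); pose proof (cosh_sqr (u n)).
      unfold tanh; apply Rmult_eq_reg_r with (cosh (u n) ^ 2); [|now apply pow_nonzero].
      field_simplify; lra.
    + exact Hh0.
    + intros n Hn; rewrite !HS.
      destruct (Hab n ltac:(lia)) as [-> ->], (Hab (S n) ltac:(lia)) as [-> ->].
      rewrite Nat.sub_succ, Nat.sub_0_r; unfold tanh.
      pose proof (cosh_neq_0 (u n)) as Hc; pose proof (cosh_neq_0 (u (S n))) as Hc'.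
      (* Subtraction formula for [tanh]. It is applied before [Ha] is introduced, so that [Ha] also
         takes the new form and yields a nonzero [sinh] in the denominator. *)
      replace (sinh (u (S n)) / cosh (u (S n)) - sinh (u n) / cosh (u n))
        with (sinh (u (S n) - u n) / (cosh (u (S n)) * cosh (u n)))
        by (rewrite sinh_minus; field; auto).
      intros Ha.
      assert (sinh (u (S n) - u n) <> 0).
      { intros E; apply Ha; rewrite E; apply Rdiv_0_l. }
      field; auto.
  - intros p u Hp Hf0 Hh0 Ha0 _ _ Hab.
    apply (neg_const_curvature_profile l f h a b nu k2 (fun n => p * cosh (u n)) _ Hnu HK Hf).
    + intros n _; apply Rmult_le_pos; [lra | apply Rlt_le, cosh_pos].
    + intros n Hn; destruct (Hab n Hn) as (Hr & -> & _).
      (* Here the first integral is [p ^ 2 + 1], and the square root squares away. *)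
      rewrite Hf0, Ha0, pow2_sqrt by exact Hr.
      rewrite Rpow_mult_distr, cosh_sqr; ring.
    + exact Hh0.
    + intros n Hn _; rewrite !HS.
      destruct (Hab n ltac:(lia)) as (_ & -> & ->), (Hab (S n) ltac:(lia)) as (_ & -> & ->).
      rewrite Nat.sub_succ, Nat.sub_0_r; unfold Rdiv; ring.
  - intros q u Hq Hf0 Hh0 Ha0 Hb0 _ Hu Hab.
    apply (neg_const_curvature_profile l f h a b nu k2 (fun n => q * sinh (u n)) _ Hnu HK Hf).
    (* The first integral fixes the radius only up to sign; [0 <= u n] selects the branch
       [q * sinh (u n)]. *)
    + intros n Hn; apply Rmult_le_pos; [lra | apply sinh_nonneg; auto].
    + intros n Hn; destruct (Hab n Hn) as (Hr & -> & _).
      rewrite Hf0, Ha0, pow2_sqrt by exact Hr.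
      (* The two values of [b] at 0 give [q * cosh (u 0) = 1], so the first integral
         [q ^ 2 * sinh (u 0) ^ 2] equals [1 - q ^ 2]. *)
      destruct (Hab 0%nat ltac:(lia)) as (_ & _ & Hb); simpl Z.of_nat in Hb.
      assert (Hq0 : (q * cosh (u 0%nat)) ^ 2 = 1) by (rewrite <- Hb, Hb0; ring).
      rewrite Rpow_mult_distr, cosh_sqr in Hq0; rewrite !Rpow_mult_distr, cosh_sqr; lra.
    + exact Hh0.
    + intros n Hn _; rewrite !HS.
      destruct (Hab n ltac:(lia)) as (_ & -> & ->), (Hab (S n) ltac:(lia)) as (_ & -> & ->).
      rewrite Nat.sub_succ, Nat.sub_0_r; reflexivity.
Qed.
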